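(* Let $m$ and $k$ be integers. Then $$\sum_{i = 1}^\infty \frac{q^{m(i - k)}}{w_{m(i - k)}\, w_{m(i + k)}} = \frac{1}{e_w u_{2km}}\left(2k\alpha - \sum_{i = 1}^{2k}\frac{w_{m(i - k) + 1}}{w_{m(i - k)}}\right).$$
   Context: Let $a,b,p,q$ be complex numbers with $q\neq 0$. The Horadam sequence $(w_n)_{n\in\mathbb{Z}}=(w_n(a,b;p,q))_{n\in\mathbb{Z}}$ is defined by $w_0=a$, $w_1=b$, $w_n=pw_{n-1}-qw_{n-2}$, extended by the same recurrence to all integer indices. Put $u_n=w_n(0,1;p,q)$. Let $\alpha,\beta$ be the roots of $x^2-px+q=0$; they are assumed distinct, i.e. $\Delta=p^2-4q\neq 0$, with $|\alpha|>|\beta|$. For all $n\in\mathbb{Z}$, $w_n=\frac{A\alpha^n-B\beta^n}{\alpha-\beta}$ with $A=b-a\beta$, $B=b-a\alpha$, and $u_n=\frac{\alpha^n-\beta^n}{\alpha-\beta}$. Put $e_w=-AB=pab-qa^2-b^2$. All quantities occurring in denominators are understood to be nonzero. Infinite series denote limits of partial sums. Summation convention for an integer upper limit $M\le 0$: $\sum_{i=1}^{0}g(i)=0$ and $\sum_{i=1}^{M}g(i)=-\sum_{i=M+1}^{0}g(i)$ for $M<0$.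
   Formalization: The formal theorem assumes m > 0: for m = 0 the denominator u_{2km} vanishes, and for m < 0 the printed formula is false, since the limit is then β instead of α (e.g. a=2, b=5, p=3, q=2, m=-1, k=1 gives -2 on the left and -10/9 on the right). *)

(* Defs.v *)
From HB Require Import structures.
From mathcomp Require Import all_boot all_order all_algebra.
From mathcomp Require Import complex.
From mathcomp Require Import all_classical all_reals all_analysis.
From mathcomp Require Import zify ring.

Set Implicit Arguments.
Unset Strict Implicit.
Unset Printing Implicit Defensive.

Import Order.TTheory GRing.Theory Num.Theory.
Import numFieldNormedType.Exports.

Local Open Scope ring_scope.

Section Horadam.
Variables (F : fieldType) (a b p q : F).

(* A state (x, y) stands for (w_n, w_{n+1}). *)
Definition horadam_next (s : F * F) : F * F := (s.2, p * s.2 - q * s.1).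

(* The recurrence solved for its oldest term, w_{n-1} = (p w_n - w_{n+1}) / q. *)
Definition horadam_prev (s : F * F) : F * F := ((p * s.1 - s.2) / q, s.1).

(* Negz n is the integer - n.+1. *)
Definition horadam (n : int) : F :=
  match n with
  | Posz n => (iter n horadam_next (a, b)).1
  | Negz n => (iter n.+1 horadam_prev (a, b)).1
  end.

Definition horadam_e : F := p * a * b - q * a ^+ 2 - b ^+ 2.

Lemma horadam0 : horadam 0 = a. Proof. by []. Qed.

Lemma horadam1 : horadam 1 = b. Proof. by []. Qed.

Lemma horadam_rec (n : int) : q != 0 ->
  horadam n = p * horadam (n - 1) - q * horadam (n - 2).
Proof.
move=> q0.
have nextE k : (iter k horadam_next (a, b)).2 = (iter k.+1 horadam_next (a, b)).1.
  by [].
have prevE k : (iter k.+1 horadam_prev (a, b)).2 = (iter k horadam_prev (a, b)).1.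
  by [].
case: n => [[|[|n]]|n].
- rewrite (_ : 0 - 1 = Negz 0)// (_ : 0 - 2 = Negz 1)//=.
  by field.
- rewrite (_ : 1%:Z - 1 = 0)// (_ : 1%:Z - 2 = Negz 0)//=.
  by field.
- rewrite (_ : n.+2%:Z - 1 = n.+1); last by lia.
  by rewrite (_ : n.+2%:Z - 2 = n)//; lia.
- rewrite (_ : Negz n - 1 = Negz n.+1); last by lia.
  rewrite (_ : Negz n - 2 = Negz n.+2); last by lia.
  rewrite /horadam !(iterS n.+2) !(iterS n.+1) !(iterS n) /horadam_prev /=.
  by field.
Qed.

Lemma horadam_eE (alpha beta : F) :
  alpha + beta = p -> alpha * beta = q ->
  horadam_e = - ((b - a * beta) * (b - a * alpha)).
Proof. by rewrite /horadam_e => <- <-; ring. Qed.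

End Horadam.

(* The sum of g i for i from 1 to M, where for M = - n.+1 < 0 it means minus the
   sum over M + 1 <= i <= 0, i.e. over i = - j with 0 <= j <= n. *)
Definition sum_from1 (V : zmodType) (M : int) (g : int -> V) : V :=
  match M with
  | Posz n => \sum_(1 <= i < n.+1) g i%:Z
  | Negz n => - \sum_(0 <= j < n.+1) g (- j%:Z)
  end.

(* The complex numbers as a number field, so that they carry the topology of the
   norm `|x|; the bare type R[i] has no topological structure in the library. *)
Definition cplx (R : realType) : numClosedFieldType := R[i].

(* Main.v *)
(* Cross-multiplying with Binet's formula gives the d'Ocagne-type identity
   w_{s+r+1} w_s - w_{s+1} w_{s+r} = e_w q^s u_r, so with r = 2km and
   R(i) = w_{m(i-k)+1} / w_{m(i-k)} the i-th summand is
   (R(i + 2k) - R(i)) / (e_w u_{2km}).  The sum over i <= n telescopes to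
   sum_{i=1}^{2k} (R(n + i) - R(i)), and R(n) tends to alpha because
   |beta / alpha| < 1 and A B = - e_w is nonzero. *)
Require Import Defs.
From mathcomp Require Import all_boot all_order all_algebra.
From mathcomp Require Import complex.
From mathcomp Require Import all_classical all_reals all_analysis.
From mathcomp Require Import zify ring.

Import Order.TTheory GRing.Theory Num.Theory.
Import numFieldNormedType.Exports.

Local Open Scope classical_set_scope.
Local Open Scope ring_scope.

(** Agreement on two consecutive indices propagates upwards by the recurrence, and downwards because
    [q] can be cancelled. *)
Lemma linear_rec2_unique (F : fieldType) (p q : F) (f g : int -> F) :
  q != 0 ->
  (forall n, f n = p * f (n - 1) - q * f (n - 2)) ->
  (forall n, g n = p * g (n - 1) - q * g (n - 2)) ->
  f 0 = g 0 -> f 1 = g 1 -> f =1 g.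
Proof.
move=> q0 fE gE fg0 fg1 n.
suff [] : f n = g n /\ f (n + 1) = g (n + 1) by [].
elim/int_ind: n => [|n [IH IH1]|n [IH IH1]]; first by rewrite add0r.
- rewrite -addn1 PoszD; split=> //; rewrite fE gE.
  rewrite (_ : n%:Z + 1 + 1 - 1 = n%:Z + 1); last by lia.
  by rewrite (_ : n%:Z + 1 + 1 - 2 = n%:Z) ?IH ?IH1 //; lia.
(* Downward step: the recurrence at [- n + 1] determines [q * f (- n.+1)] from the two values
   already known to agree. *)
- have shift : - n.+1%:Z + 1 = - n%:Z by lia.
  rewrite shift; split=> //; apply: (mulfI q0).
  have := fE (- n%:Z + 1); have := gE (- n%:Z + 1).
  rewrite (_ : - n%:Z + 1 - 1 = - n%:Z); last by lia.
  rewrite (_ : - n%:Z + 1 - 2 = - n.+1%:Z); last by lia.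
  by rewrite IH IH1 => -> /addrI/oppr_inj.
Qed.

Section Binet.
Variables (F : fieldType) (alpha beta : F).
Hypotheses (alpha0 : alpha != 0) (beta0 : beta != 0) (ab : alpha - beta != 0).

(** Both roots satisfy the characteristic equation, so the closed form obeys the same recurrence;
    its values at 0 and 1 are [a] and [b]. *)
Lemma horadam_binet (a b : F) (n : int) :
  horadam a b (alpha + beta) (alpha * beta) n =
  ((b - a * beta) * alpha ^ n - (b - a * alpha) * beta ^ n) / (alpha - beta).
Proof.
have q0 : alpha * beta != 0 by rewrite mulf_neq0.
pose g (i : int) :=
  ((b - a * beta) * alpha ^ i - (b - a * alpha) * beta ^ i) / (alpha - beta).
suff /(_ n) : horadam a b (alpha + beta) (alpha * beta) =1 g by [].
apply: (linear_rec2_unique _ (alpha + beta) _ _ _ q0); rewrite {}/g.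
- by move=> i; exact: horadam_rec.
- move=> {}n; have [j ->] : exists j, n = j + 1 + 1 by exists (n - 2); lia.
  rewrite addrK (_ : j + 1 + 1 - 2 = j); last by lia.
  rewrite !expfzDr// !expr1z; field.
  by rewrite ab.
- by rewrite horadam0 !expr0z; field.
- by rewrite horadam1 !expr1z; field.
Qed.

(** After Binet's formula the pure powers of [alpha] and of [beta] cancel; the mixed terms share the
    factor $-AB(\alpha\beta)^s$. *)
Lemma horadam_docagne (a b : F) (s r : int) :
  let w := horadam a b (alpha + beta) (alpha * beta) in
  w (s + r + 1) * w s - w (s + 1) * w (s + r) =
  horadam_e a b (alpha + beta) (alpha * beta) * (alpha * beta) ^ s *
    horadam 0 1 (alpha + beta) (alpha * beta) r.
Proof.
move=> w; rewrite /w /horadam_e !horadam_binet expfzMl !expfzDr// !expr1z.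
by field.
Qed.

End Binet.

Section SumFrom1.
Variable V : zmodType.
Implicit Types (M : int) (g : int -> V).

(** The sign convention makes this hold across 0 as well, which allows induction on [M] in both
    directions. *)
Lemma sum_from1S M g : sum_from1 (M + 1) g = sum_from1 M g + g (M + 1).
Proof.
case: M => [n|[|n]].
- by rewrite -PoszD addn1 /= big_nat_recr.
- by rewrite /= big_nat1 big_geq // oppr0 addNr.
- rewrite (_ : Negz n.+1 + 1 = Negz n); last by lia.
  by rewrite /= [in RHS]big_nat_recr//= opprD -addrA NegzE addNr addr0.
Qed.

Lemma sum_from1_shift1 M g :
  sum_from1 M (fun i => g (i + 1)) - sum_from1 M g = g (M + 1) - g 1.
Proof.
(* The defect between the two sides is the same at [N + 1] as at [N], so one identity serves both
   directions of the induction. *)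
have step N : sum_from1 (N + 1) (fun i => g (i + 1)) - sum_from1 (N + 1) g
    - (g (N + 1 + 1) - g 1) =
    sum_from1 N (fun i => g (i + 1)) - sum_from1 N g - (g (N + 1) - g 1).
  rewrite !sum_from1S opprD addrACA !opprB -[LHS]addrA; congr (_ + _).
  by rewrite addrC addrA subrK.
apply/eqP; rewrite -subr_eq0; apply/eqP.
elim/int_ind: M => [|n IH|n IH].
- by rewrite add0r /= !big_geq// !subrr.
- by rewrite -addn1 PoszD step.
- by rewrite -step (_ : - n.+1%:Z + 1 = - n%:Z) //; lia.
Qed.

(** Exchanges shift and length: [n] moves from the range of summation into the argument, leaving a
    range fixed by [M], over which limits can be taken termwise. *)
Lemma telescope_sum_from1 M g (n : nat) :
  \sum_(1 <= i < n.+1) (g (i%:Z + M) - g i%:Z) =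
  sum_from1 M (fun i => g (i + n%:Z)) - sum_from1 M g.
Proof.
elim: n => [|n IH].
  rewrite big_geq//; under [X in sum_from1 M X]eq_fun do rewrite addr0.
  by rewrite subrr.
rewrite big_nat_recr//= IH.
have := sum_from1_shift1 M (fun i => g (i + n%:Z)).
rewrite (_ : (fun i => g (i + 1 + n%:Z)) = (fun i => g (i + n.+1%:Z))); last first.
  by apply/funext => i; congr g; lia.
rewrite (_ : M + 1 + n%:Z = n.+1%:Z + M); last by lia.
rewrite (_ : 1 + n%:Z = n.+1%:Z); last by lia.
by move=> <-; rewrite addrC addrA subrK.
Qed.

End SumFrom1.

Lemma cvg_sum_from1 (K : numFieldType) (M : int) (f : int -> nat -> K) (l : K) :
  (forall i, f i n @[n --> \oo] --> l) ->
  sum_from1 M (fun i => f i n) @[n --> \oo] --> M%:~R * l.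
Proof.
move=> fl.
elim/int_ind: M => [|n IH|n IH].
- rewrite mul0r (_ : (fun n => _) = fun=> 0); first exact: cvg_cst.
  by apply/funext => n; rewrite /= big_geq.
- rewrite -addn1 PoszD rmorphD mulrDl mul1r.
  under eq_fun do rewrite sum_from1S.
  exact: cvgD.
- have shift : - n.+1%:Z + 1 = - n%:Z by lia.
  have -> : (fun j => sum_from1 (- n.+1%:Z) (f ^~ j)) =
      (fun j => sum_from1 (- n%:Z) (f ^~ j) - f (- n%:Z) j).
    by apply/funext => j; rewrite -shift sum_from1S addrK.
  rewrite (_ : (- n.+1%:Z)%:~R * l = (- n%:Z)%:~R * l - l); first exact: cvgB.
  by rewrite -shift rmorphD/= mulrDl mul1r addrK.
Qed.

Lemma cvg_exprC (R : realType) (z : cplx R) :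
  `|z| < 1 -> z ^+ n @[n --> \oo] --> (0 : cplx R).
Proof.
(* The norm on [cplx R] is complex-valued; its real part [t] brings the claim back to real geometric
   sequences. *)
move=> z1; pose t : R := complex.Re `|z|.
have zE : `|z| = (t%:C)%C by rewrite /t normc_def.
have t0 : 0 <= t by rewrite -lecR -zE normr_ge0.
have t1 : `|t| < 1 by rewrite ger0_norm // -ltcR -zE.
apply/cvgr0Pnorm_lt => eps eps0.
(* In the order on complex numbers, a positive [eps] has zero imaginary part. *)
have epsE : eps = ((complex.Re eps)%:C)%C.
  by move: eps0; case: eps => x y; rewrite ltcE/= => /andP[/eqP -> _].
have re0 : 0 < complex.Re eps by rewrite -ltcR -epsE.
move/cvgr0Pnorm_lt: (cvg_expr t1) => /(_ _ re0); apply: filterS => n.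
rewrite normrX ger0_norm// => tn.
suff : `|z ^+ n| < eps by [].
by rewrite normrX zE -rmorphXn/= epsE ltcR.
Qed.

Lemma cvg_binet_ratio (R : realType) (A B alpha beta : cplx R) (m c : int) :
  A != 0 -> beta != 0 -> `|beta| < `|alpha| -> 0 < m ->
  (A * alpha ^ (m * (c + n%:Z) + 1) - B * beta ^ (m * (c + n%:Z) + 1)) /
  (A * alpha ^ (m * (c + n%:Z)) - B * beta ^ (m * (c + n%:Z)))
    @[n --> \oo] --> alpha.
Proof.
move=> A0 beta0 ltba; case: m => // m m0.
have alpha0 : alpha != 0 by rewrite -normr_gt0 (le_lt_trans _ ltba).
(* [y n] is $(\beta/\alpha)^{m(c+n)}$, split into a constant, whose exponent may be negative, and a
   geometric sequence with ratio of norm below 1. *)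
pose r := beta / alpha; pose y n := r ^ (m%:Z * c) * (r ^+ m) ^+ n.
have r1 : `|r| < 1 by rewrite normf_div ltr_pdivrMr ?normr_gt0// mul1r.
have y0 : y n @[n --> \oo] --> (0 : cplx R).
  rewrite -(mulr0 (r ^ (m%:Z * c))); apply: cvgM; first exact: cvg_cst.
  by apply: cvg_exprC; rewrite normrX exprn_ilt1// -lt0n.
have yE n : r ^ (m%:Z * (c + n%:Z)) = y n.
  rewrite mulrDr expfzDr ?mulf_neq0 ?invr_eq0// /y -PoszM -exprnP.
  by rewrite exprM.
have betaE n : beta ^ (m%:Z * (c + n%:Z)) = alpha ^ (m%:Z * (c + n%:Z)) * y n.
  by rewrite -yE -expfzMl /r mulrCA divff// mulr1.
(* Only the nonzero power of [alpha] is cancelled, so the functions agree at every [n], even where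
   the denominator vanishes and the quotient is 0 by convention. *)
have -> : (fun n : nat =>
    (A * alpha ^ (m%:Z * (c + n%:Z) + 1) - B * beta ^ (m%:Z * (c + n%:Z) + 1)) /
    (A * alpha ^ (m%:Z * (c + n%:Z)) - B * beta ^ (m%:Z * (c + n%:Z)))) =
    (fun n => (A * alpha - B * beta * y n) / (A - B * y n)).
  apply/funext => n; rewrite !expfzDr// !expr1z betaE.
  set x := alpha ^ _; have x0 : x != 0 by rewrite expfz_neq0.
  rewrite (_ : _ - _ = x * (A * alpha - B * beta * y n)); last by ring.
  rewrite (_ : A * x - _ = x * (A - B * y n)); last by ring.
  by rewrite -mulf_div divff// mul1r.
have lim C D : C - D * y n @[n --> \oo] --> C.
  rewrite -[X in _ --> X]subr0 -(mulr0 D).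
  by apply: cvgB; [|apply: cvgM]; try exact: cvg_cst.
have alphaE : alpha = A * alpha / A by rewrite mulrAC divff// mul1r.
rewrite [X in _ --> X]alphaE.
exact: cvgM (lim (A * alpha) (B * beta)) (cvgV A0 (lim A B)).
Qed.

Theorem corollary6 (R : realType) (a b p q alpha beta : cplx R) (m k : int) :
  let w := horadam a b p q in
  let u := horadam 0 1 p q in
  let e_w := horadam_e a b p q in
  q != 0 ->
  p ^+ 2 - 4 * q != 0 ->
  alpha ^+ 2 - p * alpha + q = 0 ->
  beta ^+ 2 - p * beta + q = 0 ->
  `|beta| < `|alpha| ->
  0 < m ->
  (forall i : nat, (0 < i)%N ->
     w (m * (i%:Z - k)) != 0 /\ w (m * (i%:Z + k)) != 0) ->
  e_w != 0 ->
  u (2 * k * m) != 0 ->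
  (fun n : nat => \sum_(1 <= i < n.+1)
     q ^ (m * (i%:Z - k)) / (w (m * (i%:Z - k)) * w (m * (i%:Z + k)))) @ \oo -->
  1 / (e_w * u (2 * k * m)) *
    ((2 * k)%:~R * alpha -
       sum_from1 (2 * k) (fun i => w (m * (i - k) + 1) / w (m * (i - k)))).
Proof.
move=> w u e_w q0 _ alphaE betaE ltba m0 w_neq0 e0 u0.
have ab : alpha - beta != 0.
  by rewrite subr_eq0; apply: contraTneq ltba => ->; rewrite ltxx.
have pE : p = alpha + beta.
  (* Subtracting the two quadratic equations gives $(\alpha-\beta)(\alpha+\beta-p)=0$. *)
  apply/eqP; rewrite eq_sym -subr_eq0 -(mulrI_eq0 _ (mulfI ab)); apply/eqP.
  rewrite (_ : _ * _ = (alpha ^+ 2 - p * alpha + q) - (beta ^+ 2 - p * beta + q)).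
    by rewrite alphaE betaE subrr.
  by ring.
have qE : q = alpha * beta.
  apply/eqP; rewrite -subr_eq0; apply/eqP; rewrite -alphaE pE; ring.
have [alpha0 beta0] : alpha != 0 /\ beta != 0.
  by move: q0; rewrite qE mulf_eq0 negb_or => /andP[].
(* This is $A$, the leading coefficient in Binet's formula and a factor of $e_w=-AB$. *)
have A0 : b - a * beta != 0.
  apply: contra_neq e0 => A0.
  by rewrite /e_w (horadam_eE _ _ (esym pE) (esym qE)) A0 mul0r oppr0.
pose ratio i := w (m * (i - k) + 1) / w (m * (i - k)).
have termE (i : nat) : (0 < i)%N ->
    q ^ (m * (i%:Z - k)) / (w (m * (i%:Z - k)) * w (m * (i%:Z + k))) =
    1 / (e_w * u (2 * k * m)) * (ratio (i%:Z + 2 * k) - ratio i%:Z).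
  move=> /w_neq0[ws wt].
  have := horadam_docagne _ _ _ alpha0 beta0 ab a b (m * (i%:Z - k)) (2 * k * m).
  rewrite -pE -qE -/w -/u -/e_w /=.
  rewrite (_ : m * (i%:Z - k) + 2 * k * m = m * (i%:Z + k)); last by ring.
  rewrite /ratio (_ : i%:Z + 2 * k - k = i%:Z + k); last by ring.
  move=> docagne.
  rewrite (_ : _ / _ - _ / _ = (w (m * (i%:Z + k) + 1) * w (m * (i%:Z - k)) -
    w (m * (i%:Z - k) + 1) * w (m * (i%:Z + k))) /
    (w (m * (i%:Z - k)) * w (m * (i%:Z + k)))); last first.
    by field; rewrite ws wt.
  rewrite docagne; field.
  by rewrite e0 u0 ws wt.
have -> : (fun n : nat => \sum_(1 <= i < n.+1)
     q ^ (m * (i%:Z - k)) / (w (m * (i%:Z - k)) * w (m * (i%:Z + k)))) =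
  (fun n => 1 / (e_w * u (2 * k * m)) *
     (sum_from1 (2 * k) (fun i => ratio (i + n%:Z)) - sum_from1 (2 * k) ratio)).
  apply/funext => n; rewrite -telescope_sum_from1 mulr_sumr.
  by rewrite !big_nat; apply: eq_bigr => i /andP[i0 _]; exact: termE.
apply: cvgM; first exact: cvg_cst.
apply: cvgB; last exact: cvg_cst.
apply: cvg_sum_from1 => i.
have lim := cvg_binet_ratio _ _ (b - a * alpha) _ _ _ (i - k) A0 beta0 ltba m0.
rewrite (_ : (fun n => ratio (i + n%:Z)) = (fun n =>
  ((b - a * beta) * alpha ^ (m * (i - k + n%:Z) + 1) -
   (b - a * alpha) * beta ^ (m * (i - k + n%:Z) + 1)) /
  ((b - a * beta) * alpha ^ (m * (i - k + n%:Z)) -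
   (b - a * alpha) * beta ^ (m * (i - k + n%:Z))))); first exact: lim.
(* The Binet denominators [alpha - beta] cancel in the quotient at every [n], also where [w]
   vanishes. *)
apply/funext => n; rewrite /ratio /w pE qE !horadam_binet// (addrAC i).
by rewrite invf_div mulrA divfK.
Qed.
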